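(* Let $p$ be a prime number. For $i=1,2$ let $S_i$ be an association scheme on $X_i$ such that $\mathbf{O}^{\theta}(S_i)\simeq C_p\times C_p$, $\{n_s\mid s\in S_i\setminus\mathbf{O}^{\theta}(S_i)\}=\{p\}$ and $\delta(S_i)=3$, where $\delta(S_i)=n_{S_i}/n_{\mathbf{O}^{\theta}(S_i)}$. Then $S_1$ is isomorphic to $S_2$.
   Context: An association scheme on a non-empty set $X$ is a partition $S$ of $X\times X$ such that (1) $1_X=\{(x,x)\mid x\in X\}\in S$; (2) for each $s\in S$, $s^*=\{(x,y)\mid (y,x)\in s\}\in S$; (3) for all $s,t,u\in S$, the number $c_{st}^u=|xs\cap yt^*|$ is the same for all $(x,y)\in u$, where $xs=\{y\in X\mid (x,y)\in s\}$. The valency of $s$ is the positive integer $n_s=c_{ss^*}^{1_X}$; for $U\subseteq S$ put $n_U=\sum_{u\in U}n_u$; $n_S$ is the (finite) order of $S$. For nonempty $P,Q\subseteq S$, the complex product $PQ$ is the set of $s\in S$ with $c_{pq}^s\ne 0$ for some $p\in P$, $q\in Q$ (singletons $\{s\}$ are written $s$). A subset $T\subseteq S$ is closed if $\bigcup_{t\in T}t$ is an equivalence relation on $X$; it is strongly normal if moreover $s^*Ts\subseteq T$ for every $s\in S$. The thin residue $\mathbf{O}^{\theta}(S)$ is the intersection of all strongly normal closed subsets of $S$. A closed subset $T$ is thin if all its elements have valency $1$; then it is a group under the relational product. The condition $\mathbf{O}^{\theta}(S)\simeq C_p\times C_p$ means that $\mathbf{O}^{\theta}(S)$ is thin and, as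 a group, isomorphic to $C_p\times C_p$. An isomorphism between schemes $S_1$ on $X_1$ and $S_2$ on $X_2$ is a bijection $\phi:X_1\cup S_1\to X_2\cup S_2$ with $\phi(X_1)\subseteq X_2$, $\phi(S_1)\subseteq S_2$, and $(\phi(x),\phi(y))\in\phi(s)$ whenever $x,y\in X_1$, $s\in S_1$ and $(x,y)\in s$. *)

(* Defs.v *)
(* X is a finType because n_S = |X| is finite. *)
From mathcomp Require Import all_boot all_order all_algebra all_fingroup.
Set Implicit Arguments.
Unset Strict Implicit.
Unset Printing Implicit Defensive.

Section Schemes.
Variable X : finType.
Implicit Types (s t u : {set X * X}) (S T P Q : {set {set X * X}}).

Definition diag : {set X * X} := [set z | z.1 == z.2].

Definition conv s : {set X * X} := [set z | (z.2, z.1) \in s].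

Definition relprod s t : {set X * X} :=
  [set z | [exists y, ((z.1, y) \in s) && ((y, z.2) \in t)]].

Definition nbhd x s : {set X} := [set y | (x, y) \in s].

(* partition excludes the empty relation, so all elements of S are nonempty. *)
Definition is_scheme S : Prop :=
  [/\ 0 < #|X|, partition S [set: X * X], diag \in S,
      forall s, s \in S -> conv s \in S
    & forall s t u, s \in S -> t \in S -> u \in S ->
      forall x y x' y', (x, y) \in u -> (x', y') \in u ->
      #|nbhd x s :&: nbhd y (conv t)| = #|nbhd x' s :&: nbhd y' (conv t)|].

(* c_{st}^u, read off at an arbitrary pair in u; see scheme_constE. *)
Definition scheme_const s t u : nat :=
  if [pick z in u] is Some z then #|nbhd z.1 s :&: nbhd z.2 (conv t)| else 0.

Definition valency s : nat := scheme_const s (conv s) diag.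

Definition valency_sum T : nat := \sum_(t in T) valency t.

Definition cprod S P Q : {set {set X * X}} :=
  [set s in S | [exists p in P, [exists q in Q, scheme_const p q s != 0]]].

Definition is_equivalence s : bool :=
  [&& [forall x, (x, x) \in s],
      [forall x, [forall y, ((x, y) \in s) ==> ((y, x) \in s)]]
    & [forall x, [forall y, [forall z,
        ((x, y) \in s) && ((y, z) \in s) ==> ((x, z) \in s)]]]].

Definition closed_subset S T : bool := (T \subset S) && is_equivalence (cover T).

Definition strongly_normal S T : bool :=
  closed_subset S T &&
  [forall s in S, cprod S (cprod S [set conv s] T) [set s] \subset T].

Definition thin_residue S : {set {set X * X}} :=
  \bigcap_(T : {set {set X * X}} | strongly_normal S T) T.

Definition thin S T : bool :=
  closed_subset S T && [forall t in T, valency t == 1].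

(* f transports the group law of gT to the relational product on T. *)
Definition thin_isog S T (gT : finGroupType) : Prop :=
  thin S T /\
  exists f : gT -> {set X * X},
    [/\ injective f, f @: [set: gT] = T
      & {morph f : a b / (a * b)%g >-> relprod a b}].

Definition delta S : rat := ((valency_sum S)%:R / (valency_sum (thin_residue S))%:R)%R.

Lemma scheme_constE S s t u x y :
  is_scheme S -> s \in S -> t \in S -> u \in S -> (x, y) \in u ->
  scheme_const s t u = #|nbhd x s :&: nbhd y (conv t)|.
Proof.
case=> _ _ _ _ H sS tS uS xyu; rewrite /scheme_const.
case: pickP => [[x' y'] /= xyu'|/(_ (x, y))]; last by rewrite xyu.
exact: (H s t u).
Qed.

End Schemes.

(* The union of X and S is disjoint, hence a sum type; phi is the bijection and
   f, g are its restrictions to points and to relations. *)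
Definition scheme_isomorphic (X1 X2 : finType)
    (S1 : {set {set X1 * X1}}) (S2 : {set {set X2 * X2}}) : Prop :=
  exists (phi : X1 + {s | s \in S1} -> X2 + {s | s \in S2})
         (f : X1 -> X2) (g : {s | s \in S1} -> {s | s \in S2}),
    [/\ bijective phi,
        forall x, phi (inl x) = inl (f x),
        forall s, phi (inr s) = inr (g s)
      & forall x y (s : {s | s \in S1}),
          (x, y) \in val s -> (f x, f y) \in val (g s)].

(* Main.v *)
(* Write N for the thin residue. It acts regularly on each of its three classes
   on X, and a relation s0 outside N permutes these classes without fixed point,
   hence cyclically; call (x, y) an arrow if y lies in the image under s0 of the
   class of x. Since N is abelian and relations outside N have valency p, the
   stabilizers R and L of the relation of an arrow, under the action of N on its
   head and on its tail, are subgroups of order p that do not depend on the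
   arrow. If L = R, this subgroup would be strongly normal, against the
   minimality of N; hence N = L * R. Some generators l of L and r of R are such
   that moving the tail of an arrow by r amounts to moving its head by l. A
   suitable choice of base points in the three classes, forming an s0-cycle,
   then identifies X with Z_3 x Z_p x Z_p in such a way that the relation
   containing a pair is read off an explicit formula (model_color) depending on
   p only. *)
Require Import Defs.
From mathcomp Require Import all_boot all_order all_algebra all_fingroup.
From mathcomp Require Import cyclic.
Set Implicit Arguments.
Unset Strict Implicit.
Unset Printing Implicit Defensive.

(** * Colors of pairs of points *)

Definition color (X : finType) (S : {set {set X * X}}) (x y : X) :=
  pblock S (x, y).

Section Color.
Variables (X : finType) (S : {set {set X * X}}).
Hypothesis schemeS : is_scheme S.
Implicit Types (x y z : X) (s t u : {set X * X}).
Local Notation c := (color S).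

Let trivS : trivIset S.
Proof. by case: schemeS => _ /and3P[]. Qed.

Let coverS : cover S = setT.
Proof. by case: schemeS => _ /and3P[/eqP]. Qed.

Lemma mem_color x y : (x, y) \in c x y.
Proof. by rewrite mem_pblock coverS. Qed.

Lemma color_in x y : c x y \in S.
Proof. by rewrite pblock_mem // coverS. Qed.

Lemma in_color s x y : s \in S -> ((x, y) \in s) = (c x y == s).
Proof.
move=> sS; apply/idP/eqP=> [xys|<-]; last exact: mem_color.
exact: def_pblock.
Qed.

Lemma scheme_neq0 s : s \in S -> exists w, w \in s.
Proof.
case: schemeS => _ /and3P[_ _ S0] _ _ _ sS; apply/set0Pn.
by apply: contraNneq S0 => <-.
Qed.

Lemma color_diag x y : (c x y == diag X) = (x == y).
Proof. by case: schemeS => _ _ dS _ _; rewrite -in_color // inE. Qed.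

Lemma color_xx x : c x x = diag X.
Proof. by apply/eqP; rewrite color_diag. Qed.

Lemma color_conv x y : c y x = conv (c x y).
Proof.
case: schemeS => _ _ _ cS _.
by apply/eqP; rewrite -in_color ?cS ?color_in // inE mem_color.
Qed.

Lemma color_sym x y x' y' : c x y = c x' y' -> c y x = c y' x'.
Proof. by rewrite ![c y _]color_conv (color_conv x' y') => ->. Qed.

(** The intersection number of the colors of [(x, z)] and [(z, y)] is positive at [(x, y)], as [z]
    witnesses, hence also at [(x', y')]. *)
Lemma color_triangle x y x' y' z : c x y = c x' y' ->
  exists z', c x' z' = c x z /\ c z' y' = c z y.
Proof.
case: schemeS => _ _ _ _ H e.
have xyu := mem_color x y; have xyu' := mem_color x' y'.
rewrite -e in xyu'.
have /(_ _ _ _ _ xyu xyu') e' := H _ _ _ (color_in x z) (color_in z y) (color_in x y).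
have : 0 < #|nbhd x (c x z) :&: nbhd y (conv (c z y))|.
  by apply/card_gt0P; exists z; rewrite !inE !mem_color.
rewrite e' => /card_gt0P[z']; rewrite !inE !in_color ?color_in //=.
by case/andP=> /eqP ? /eqP ?; exists z'.
Qed.

Lemma card_color s x : s \in S -> #|[set y | c x y == s]| = valency s.
Proof.
case: (schemeS) => _ _ dS cS _ sS.
have xx : (x, x) \in diag X by rewrite inE.
rewrite /valency (scheme_constE schemeS sS (cS _ sS) dS xx).
by apply: eq_card => y; rewrite !inE /= -in_color // andbb.
Qed.

Lemma color_exists s x : s \in S -> exists y, c x y = s.
Proof.
move=> sS; have [[u v] uvs] := scheme_neq0 sS.
have /eqP e : c u v == s by rewrite -in_color.
(* The pairs [(u, u)] and [(x, x)] share the color [diag X], so the third vertex [v] can be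
   transported. *)
have [|z [ez _]] := @color_triangle u u x x v; last by exists z; rewrite ez.
by rewrite !color_xx.
Qed.

Lemma valency_sum_scheme : valency_sum S = #|X|.
Proof.
case: (schemeS) => /card_gt0P[x _] _ _ _ _.
rewrite -sum1_card (partition_big (c x) (mem S)) /=; last first.
  by move=> y _; rewrite color_in.
rewrite /valency_sum; apply: eq_bigr => s sS.
rewrite -(card_color x sS) -sum1_card.
by apply: eq_bigl => y; rewrite inE.
Qed.

Lemma cprod_color (P Q : {set {set X * X}}) x y :
  P \subset S -> Q \subset S ->
  reflect (exists z, c x z \in P /\ c z y \in Q) (c x y \in Defs.cprod S P Q).
Proof.
move=> PS QS; rewrite inE color_in /=.
have neq0 s t : s \in S -> t \in S ->
    reflect (exists z, c x z = s /\ c z y = t) (scheme_const s t (c x y) != 0).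
  move=> sS tS.
  rewrite (scheme_constE schemeS sS tS (color_in x y) (mem_color x y)) -lt0n.
  apply: (iffP card_gt0P) => -[z].
    by rewrite !inE /= !in_color // => /andP[/eqP ? /eqP ?]; exists z.
  by case=> es et; exists z; rewrite !inE /= !in_color // es et !eqxx.
apply: (iffP exists_inP) => [[s sP /exists_inP[t tQ]]|[z [zP zQ]]].
  case/(neq0 _ _ (subsetP PS _ sP) (subsetP QS _ tQ)) => z [es et].
  by exists z; rewrite es et.
exists (c x z) => //; apply/exists_inP; exists (c z y) => //.
by apply/neq0; rewrite ?color_in //; exists z.
Qed.

Lemma mem_cover_color (T : {set {set X * X}}) x y :
  T \subset S -> ((x, y) \in cover T) = (c x y \in T).
Proof.
move=> TS; apply/bigcupP/idP => [[t tT]|cT].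
  by rewrite in_color ?(subsetP TS) // => /eqP ->.
by exists (c x y); rewrite ?mem_color.
Qed.

Lemma closed_colorP (T : {set {set X * X}}) :
  reflect [/\ T \subset S, forall x, c x x \in T,
              forall x y, c x y \in T -> c y x \in T
            & forall x y z, c x y \in T -> c y z \in T -> c x z \in T]
          (closed_subset S T).
Proof.
apply: (iffP andP) => [[TS /and3P[/forallP rT /forallP sT /forallP tT]]|[TS rT sT tT]].
  split=> // [x|x y|x y z]; rewrite -!mem_cover_color //.
  - by move: (sT x) => /forallP/(_ y)/implyP.
  - move=> xy yz; move: (tT x) => /forallP/(_ y)/forallP/(_ z).
    by rewrite xy yz.
split=> //; apply/and3P; split; apply/forallP => x.
- by rewrite mem_cover_color.
- by apply/forallP=> y; apply/implyP; rewrite !mem_cover_color //; apply: sT.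
apply/forallP=> y; apply/forallP=> z; apply/implyP.
by rewrite !mem_cover_color // => /andP[]; apply: tT.
Qed.

(** A relation in the product of [conv s], [T] and [s] joins the heads of two pairs of color [s]
    whose tails are related by [T]. *)
Lemma strongly_normal_colorP (T : {set {set X * X}}) :
  reflect (closed_subset S T /\
    forall x y x' y', c x y = c x' y' -> c x x' \in T -> c y y' \in T)
  (strongly_normal S T).
Proof.
have subS P Q : Defs.cprod S P Q \subset S by apply/subsetP=> s; rewrite inE => /andP[].
have convS s : s \in S -> [set conv s] \subset S.
  by case: (schemeS) => _ _ _ cS _ sS; rewrite sub1set cS.
apply: (iffP andP) => -[clT nT]; split=> //; have [TS _ _ _] := closed_colorP _ clT.
  move=> x y x' y' e xx'.
  move/forall_inP: nT => /(_ _ (color_in x y))/subsetP; apply.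
  apply/cprod_color; rewrite ?subS // ?sub1set ?color_in //.
  exists x'; rewrite e set11; split=> //.
  apply/cprod_color; rewrite // ?convS ?color_in //.
  by exists x; rewrite color_conv e set11.
apply/forall_inP=> s sS; apply/subsetP=> u uP.
have uS : u \in S by apply: (subsetP (subS _ _)) uP.
have [[y y'] yyu] := scheme_neq0 uS.
move: yyu uP; rewrite in_color // => /eqP <-.
case/cprod_color; rewrite ?subS ?sub1set // => x' [].
case/cprod_color; rewrite ?convS // => x [/set1P cyx xx'] /set1P cx'y'.
apply: nT xx'; rewrite cx'y' color_conv cyx.
by apply/setP=> -[a b]; rewrite !inE.
Qed.

Lemma thin_residue_sub (T : {set {set X * X}}) :
  strongly_normal S T -> thin_residue S \subset T.
Proof. by move=> nT; apply: bigcap_inf. Qed.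

(** The transport condition passes to intersections. Closedness of the residue will come from its
    thinness. *)
Lemma thin_residue_strongly_normal x y x' y' :
  c x y = c x' y' -> c x x' \in thin_residue S -> c y y' \in thin_residue S.
Proof.
move=> e /bigcapP xx'; apply/bigcapP=> T nT.
by case/strongly_normal_colorP: (nT) => _ /(_ _ _ _ _ e); apply; apply: xx'.
Qed.

End Color.

(* A point is (i, (m, n)), standing for l^m r^n applied to the base point of
   class i; the last coordinate of a color is a dummy 0 when i changes. *)
Definition model_color p (u v : 'Z_3 * ('Z_p * 'Z_p)) : 'Z_3 * ('Z_p * 'Z_p) :=
  if v.1 == u.1 then (0, (v.2.1 - u.2.1, v.2.2 - u.2.2))%R
  else if v.1 == (u.1 + 1)%R then (1, (v.2.1 + u.2.2, 0))%R
  else (1 + 1, (u.2.1 + v.2.2, 0))%R.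

(** The model counterpart of [color_diag], from which [model_point] will be seen to be injective. *)
Lemma model_color_eqxx p (u v : 'Z_3 * ('Z_p * 'Z_p)) :
  model_color u v = model_color u u -> u = v.
Proof.
case: u v => [i [m n]] [j [m' n']]; rewrite /model_color /= eqxx !GRing.subrr.
case: eqP => [->|_]; last by case: eqP.
move=> e; move: (congr1 (fun k => k.2.1) e) (congr1 (fun k => k.2.2) e) => /= /eqP.
by rewrite GRing.subr_eq0 => /eqP-> /eqP; rewrite GRing.subr_eq0 => /eqP->.
Qed.

Lemma Z3_cases (i j : 'Z_3) : [|| j == i, j == (i + 1)%R | i == (j + 1)%R].
Proof. by case: i j => [[|[|[|]]]] // ? [[|[|[|]]]]. Qed.


(** * The regular action of the thin residue *)

Section ThinAction.
Variables (X : finType) (S : {set {set X * X}}).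
Hypothesis schemeS : is_scheme S.
Variables (gT : finGroupType) (f : gT -> {set X * X}).
Local Notation c := (color S).
Local Notation N := (thin_residue S).
Hypotheses (thinN : Defs.thin S N) (f_inj : injective f).
Hypotheses (f_im : f @: [set: gT] = N).
Hypothesis fM : {morph f : a b / (a * b)%g >-> relprod a b}.
Implicit Types (x y z : X) (a b : gT).

(** As [f a] has valency 1, exactly one [y] qualifies and the default [x] is never returned for lack
    of one. *)
Definition shift x a : X := odflt x [pick y | c x y == f a].

Let closedN : closed_subset S N. Proof. by case/andP: thinN. Qed.
Let NS : N \subset S. Proof. by case/andP: closedN. Qed.

Lemma sim_refl x : c x x \in N.
Proof. by case/(closed_colorP schemeS): closedN. Qed.

Lemma sim_sym x y : (c x y \in N) = (c y x \in N).
Proof. by case/(closed_colorP schemeS): closedN => _ _ sN _; apply/idP/idP; apply: sN. Qed.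

Lemma sim_trans y x z : c x y \in N -> c y z \in N -> c x z \in N.
Proof. by case/(closed_colorP schemeS): closedN => _ _ _; apply. Qed.

Lemma f_in a : f a \in N.
Proof. by rewrite -f_im imset_f. Qed.

Lemma color_shift_eq x y a : (c x y == f a) = (y == shift x a).
Proof.
have faS := subsetP NS _ (f_in a).
have /eqP: #|[set y | c x y == f a]| = 1.
  rewrite card_color //; apply/eqP.
  by case/andP: thinN => _ /forallP/(_ (f a)); rewrite f_in.
case/cards1P=> z ez; have e w : (c x w == f a) = (w == z).
  by rewrite -in_set1 -ez inE.
by rewrite e /shift; case: pickP => [w|/(_ z)] /=; rewrite e ?eqxx // => /eqP->.
Qed.

Lemma color_shift0 x a : c x (shift x a) = f a.
Proof. by apply/eqP; rewrite color_shift_eq. Qed.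

Lemma shiftM x a b : shift (shift x a) b = shift x (a * b).
Proof.
apply/eqP; rewrite -color_shift_eq -(in_color schemeS) // ?(subsetP NS) ?f_in //.
rewrite fM inE; apply/existsP; exists (shift x a); rewrite /=.
by rewrite !(in_color schemeS) // ?(subsetP NS) ?f_in // !color_shift0 !eqxx.
Qed.

Lemma shift_inj x : injective (shift x).
Proof. by move=> a b e; apply: f_inj; rewrite -!(color_shift0 x) e. Qed.

Lemma simP x y : reflect (exists a, y = shift x a) (c x y \in N).
Proof.
apply: (iffP idP) => [|[a ->]]; last by rewrite color_shift0 f_in.
rewrite -f_im => /imsetP[a _ /eqP]; rewrite color_shift_eq => /eqP.
by exists a.
Qed.

(** Nothing is assumed on [f 1]. Reflexivity gives some [e] that fixes [x]; then [e * e] and [e]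
    move [x] alike, so [e] is 1. *)
Lemma shift1 x : shift x 1 = x.
Proof.
have /simP[e xe] := sim_refl x; suff e1 : e = 1%g by rewrite -e1.
by apply/eqP; rewrite -(can_eq (mulKg e)) mulg1 -(inj_eq (@shift_inj x)) -shiftM -!xe.
Qed.

Lemma sim_shift x a : c x (shift x a) \in N.
Proof. by apply/simP; exists a. Qed.

Lemma color_shift x a b : c (shift x a) (shift x b) = f (a^-1 * b).
Proof.
by apply/eqP; rewrite color_shift_eq shiftM mulKVg.
Qed.

(** The third vertex given by [color_triangle] is reached from [y'] by the relation [f a], so it can
    only be [shift y' a]. *)
Lemma color_shiftr x y x' y' a :
  c x y = c x' y' -> c x (shift y a) = c x' (shift y' a).
Proof.
move=> e; have [w [<- e2]] := color_triangle schemeS (shift y a) e.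
have ey : c y' w = c y (shift y a) by apply: color_sym.
by congr (c _ _); apply/eqP; rewrite -color_shift_eq ey color_shift0.
Qed.

Lemma color_shiftl x y x' y' a :
  c x y = c x' y' -> c (shift x a) y = c (shift x' a) y'.
Proof.
by move=> /(color_sym schemeS) /(@color_shiftr _ _ _ _ a) /(color_sym schemeS).
Qed.

Lemma card_sim x : #|[set y | c x y \in N]| = #|gT|.
Proof.
rewrite -cardsT -(card_imset _ (@shift_inj x)); apply: eq_card => y.
rewrite inE; apply/simP/imsetP => [[a ->]|[a _ ->]]; last by exists a.
by exists a.
Qed.

Lemma sim_color x y z : c x y = c x z -> c y z \in N.
Proof. by move/(thin_residue_strongly_normal schemeS); apply; apply: sim_refl. Qed.

Definition stab x y : {set gT} := [set a | c x (shift y a) == c x y].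

Lemma stab_group_set x y : group_set (stab x y).
Proof.
apply/group_setP; split=> [|a b]; first by rewrite inE shift1.
rewrite !inE => /eqP ea /eqP eb.
by rewrite -shiftM (color_shiftr b ea) eb.
Qed.
Canonical stab_group x y := group (stab_group_set x y).

(** By [sim_color], the points with the same color as [y] from [x] lie in the class of [y], on which
    the action is regular; they correspond to the elements of the stabilizer. *)
Lemma card_stab x y : #|stab x y| = valency (c x y).
Proof.
rewrite -(card_color schemeS x) ?color_in // -(card_imset _ (@shift_inj y)).
apply: eq_card => z; rewrite [RHS]inE; apply/imsetP/eqP => [[a]|e].
  by rewrite inE => /eqP ? ->.
have /simP[a ez] := sim_color (esym e).
by exists a; rewrite // inE -ez e.
Qed.

Lemma eq_stab x y x' y' : c x y = c x' y' -> stab x y = stab x' y'.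
Proof.
by move=> e; apply/setP=> a; rewrite !inE (color_shiftr a e) e.
Qed.

Lemma stab_shiftl x y a : stab (shift x a) y = stab x y.
Proof.
apply/setP=> b; rewrite !inE; apply/eqP/eqP => [e|]; last exact: color_shiftl.
by move: (color_shiftl a^-1 e); rewrite shiftM mulgV shift1.
Qed.

Hypothesis gT_abelian : forall a b : gT, (a * b = b * a)%g.

(** Within a class, stabilizers are conjugate, hence equal in an abelian group. *)
Lemma stab_shiftr x y a : stab x (shift y a) = stab x y.
Proof.
apply/setP=> b; rewrite !inE shiftM gT_abelian -shiftM.
apply/eqP/eqP => [e|]; last exact: color_shiftr.
by move: (color_shiftr a^-1 e); rewrite !shiftM mulgV mulg1 shift1.
Qed.

(** * The cycle on the three classes of the thin residue *)

Variable p : nat.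
Hypotheses (p_prime : prime p) (card_gT : #|gT| = p ^ 2).
Hypothesis card_X : #|X| = 3 * p ^ 2.
Hypothesis valency_out : forall s, s \in S -> s \notin N -> valency s = p.

Let p2_gt0 : 0 < p ^ 2. Proof. by rewrite expn_gt0 prime_gt0. Qed.

Let sim_class x := [set y | c x y \in N].

Let card_sim_classU x y z : c x z \notin N -> c y z \notin N ->
  #|sim_class x :|: sim_class y :|: sim_class z| =
    #|sim_class x :|: sim_class y| + p ^ 2.
Proof.
move=> xz yz; rewrite cardsU card_sim card_gT disjoint_setI0 ?cards0 ?subn0 //.
rewrite disjoints_subset; apply/subsetP=> w; rewrite !inE => /orP[] xw.
  by apply: contra xz => zw; apply: sim_trans xw _; rewrite sim_sym.
by apply: contra yz => zw; apply: sim_trans xw _; rewrite sim_sym.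
Qed.

Lemma exists_not_sim x y : exists w, c x w \notin N /\ c y w \notin N.
Proof.
have: ~~ ([set: X] \subset sim_class x :|: sim_class y).
  apply/negP=> /subset_leq_card; rewrite cardsT card_X.
  apply/negP; rewrite -ltnNge; apply: leq_ltn_trans (leq_card_setU _ _) _.
  by rewrite !card_sim card_gT addnn -mul2n ltn_pmul2r.
by case/subsetPn=> w _; rewrite !inE negb_or => /andP[]; exists w.
Qed.

Lemma sim_cover x y z w : c x y \notin N -> c x z \notin N -> c y z \notin N ->
  [|| c x w \in N, c y w \in N | c z w \in N].
Proof.
move=> xy xz yz; suff: w \in sim_class x :|: sim_class y :|: sim_class z.
  by rewrite !inE orbA.
suff /eqP->: sim_class x :|: sim_class y :|: sim_class z == setT by [].
rewrite eqEcard subsetT cardsT card_X card_sim_classU //=.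
(* Taking the first two classes equal in the union formula counts the union of two classes. *)
have := card_sim_classU xy xy; rewrite setUid => ->.
by rewrite card_sim card_gT !mulSn mul0n addn0 addnA.
Qed.

Variable s0 : {set X * X}.
Hypotheses (s0S : s0 \in S) (s0N : s0 \notin N).

Definition arrow x y := [exists z, (c x z == s0) && (c z y \in N)].

Lemma arrowP x y : reflect (exists z, c x z = s0 /\ c z y \in N) (arrow x y).
Proof.
by apply: (iffP existsP) => -[z]; [move=> /andP[/eqP]|case=> /eqP]; exists z => //; apply/andP.
Qed.

Lemma arrow_color x y x' y' : c x y = c x' y' -> arrow x y -> arrow x' y'.
Proof.
move=> e /arrowP[z [xz zy]]; have [z' [e1 e2]] := color_triangle schemeS z e.
by apply/arrowP; exists z'; rewrite e1 e2.
Qed.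

(** Arrows descend to classes: by strong normality, the points reached by [s0] from [x] and from
    [x'] lie in one class. *)
Lemma arrow_sim x x' y y' :
  c x x' \in N -> c y y' \in N -> arrow x y -> arrow x' y'.
Proof.
move=> xx yy /arrowP[z [xz zy]]; have [z' x'z'] := color_exists schemeS x' s0S.
have zz' : c z z' \in N.
  by apply: (thin_residue_strongly_normal schemeS) xx; rewrite xz x'z'.
apply/arrowP; exists z'; split=> //; apply: sim_trans yy.
by apply: sim_trans zy; rewrite sim_sym.
Qed.

Lemma arrow_exists x : exists y, c x y = s0 /\ arrow x y.
Proof.
have [y xy] := color_exists schemeS x s0S; exists y; split=> //.
by apply/arrowP; exists y; rewrite sim_refl.
Qed.

Lemma arrow_not_sim x y : arrow x y -> c x y \notin N.
Proof.
move=> /arrowP[z [xz zy]]; apply: contra s0N => xy; rewrite -xz.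
by apply: sim_trans xy _; rewrite sim_sym.
Qed.

Lemma arrow_inj x x' y : arrow x y -> arrow x' y -> c x x' \in N.
Proof.
move=> /arrowP[z [xz zy]] /arrowP[z' [xz' zy']].
apply: (thin_residue_strongly_normal schemeS (x := z) (x' := z')).
  by apply: (color_sym schemeS); rewrite xz xz'.
by apply: sim_trans zy _; rewrite sim_sym.
Qed.

Lemma arrow_fun x y y' : arrow x y -> arrow x y' -> c y y' \in N.
Proof.
move=> /arrowP[z [xz zy]] /arrowP[z' [xz' zy']].
apply: sim_trans zy'; rewrite sim_sym; apply: sim_trans zy.
by apply: (@sim_color x); rewrite xz xz'.
Qed.

(* A fixed-point free permutation of three classes is a 3-cycle. *)
Lemma arrow_cycle x y z : arrow x y -> arrow y z -> arrow z x /\ c z x \notin N.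
Proof.
move=> xy yz.
have nxy := arrow_not_sim xy; have nyz := arrow_not_sim yz.
have nxz : c x z \notin N.
  (* Otherwise [s0] swaps the classes of [x] and [y], and the class of [w] has no image left: its
     own is excluded and the other two are taken. *)
  apply/negP=> xz; have [w [nxw nyw]] := exists_not_sim x y.
  have [v [_ wv]] := arrow_exists w.
  have nwv := arrow_not_sim wv.
  have := sim_cover v nxy nxw nyw; rewrite (negPf nwv) orbF => /orP[xv|yv].
    move: nyw; rewrite sim_sym (arrow_inj wv) //.
    by apply: arrow_sim yz; rewrite ?sim_refl //; apply: sim_trans xv; rewrite sim_sym.
  by move: nxw; rewrite sim_sym (arrow_inj wv) //; apply: arrow_sim xy; rewrite ?sim_refl.
have nzx : c z x \notin N by rewrite sim_sym.
split=> //; have [w [_ zw]] := arrow_exists z.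
(* The image of the class of [z] is not that of [z], nor that of [y], which is already the image of
   the class of [x]. *)
have := sim_cover w nxy nxz nyz; rewrite (negPf (arrow_not_sim zw)) orbF.
case/orP=> [xw|yw]; first by apply: arrow_sim zw; rewrite ?sim_refl // sim_sym.
case/negP: nxz; apply: arrow_inj (xy) _.
by apply: arrow_sim zw; rewrite ?sim_refl // sim_sym.
Qed.

Lemma arrow_asym x y : arrow x y -> ~~ arrow y x.
Proof.
move=> xy; apply/negP=> yx; have [_] := arrow_cycle xy yx.
by rewrite sim_refl.
Qed.

Lemma arrow_total x y : [|| c x y \in N, arrow x y | arrow y x].
Proof.
have [z [_ xz]] := arrow_exists x; have [w [_ zw]] := arrow_exists z.
have [wx nwx] := arrow_cycle xz zw; rewrite sim_sym in nwx.
case/or3P: (sim_cover y (arrow_not_sim xz) nwx (arrow_not_sim zw)) => [->//|zy|wy].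
  by rewrite (arrow_sim _ zy xz) ?sim_refl ?orbT.
by rewrite (arrow_sim wy _ wx) ?sim_refl ?orbT.
Qed.

(** * Strongly normal subsets from stabilizers *)

Lemma color_imfP (A : {set gT}) x y :
  reflect (exists2 a, a \in A & y = shift x a) (c x y \in f @: A).
Proof.
apply: (iffP imsetP) => -[a aA e]; exists a => //.
  by apply/eqP; rewrite -color_shift_eq e.
by rewrite e color_shift0.
Qed.

(** For a pair inside a class, commutativity moves head and tail alike. Otherwise moving the tail by
    [H] keeps the color, so the two heads have the same color from [x'] and differ by an element of
    the stabilizer [H]. *)
Lemma strongly_normal_imf (H : {group gT}) :
  (forall x y, arrow x y -> stab x y = H /\ stab y x = H) ->
  strongly_normal S (f @: H).
Proof.
move=> stabH; apply/strongly_normal_colorP => //; split.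
  apply/closed_colorP => //; split=> [|x|x y|x y z].
  - by apply: subset_trans NS; rewrite -f_im imsetS // subsetT.
  - by apply/color_imfP; exists 1%g; rewrite ?group1 // shift1.
  - case/color_imfP=> a aH ->; apply/color_imfP; exists a^-1%g; rewrite ?groupV //.
    by rewrite shiftM mulgV shift1.
  - case/color_imfP=> a aH -> /color_imfP[b bH ->]; apply/color_imfP.
    by exists (a * b)%g; rewrite ?groupM // shiftM.
move=> x y x' y' e /color_imfP[a aH ex']; apply/color_imfP.
case/boolP: (c x y \in N) => [/simP[g ey]|nxy].
  exists a => //; apply/eqP; rewrite ey shiftM gT_abelian -shiftM -ex'.
  by rewrite -color_shift_eq -e ey color_shift0.
have [stab_xy stab_yx] : stab x y = H /\ stab y x = H.
  move: (arrow_total x y); rewrite (negPf nxy) /= => /orP[/stabH|/stabH[]] //.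
have x'y : c x' y = c x' y'.
  rewrite -e; apply: color_sym => //; apply/eqP.
  by move: aH; rewrite -stab_yx ex' inE.
have /simP[b ey'] := sim_color x'y.
exists b => //; rewrite -stab_xy -(stab_shiftl _ _ a) inE -ex' -ey' x'y.
exact: eqxx.
Qed.

(** * Stabilizers of a base arrow *)

Variables x0 x1 : X.
Hypothesis x01 : c x0 x1 = s0.

Let arrow01 : arrow x0 x1.
Proof. by apply/arrowP; exists x1; rewrite sim_refl. Qed.

(** Along an arrow, a point [z] with [c x z = s0] lies in the class of the head, so only the head of
    the base arrow has to move. Questions about arrows reduce to this one. *)
Lemma arrow_base x y : arrow x y -> exists a, c x y = c x0 (shift x1 a).
Proof.
case/arrowP=> z [xz /simP[a ->]]; exists a.
by apply: color_shiftr; rewrite xz x01.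
Qed.

Lemma arrow_stab x y : arrow x y -> stab x y = stab x0 x1 /\ stab y x = stab x1 x0.
Proof.
case/arrow_base=> a e; rewrite (eq_stab e) stab_shiftr.
by rewrite (eq_stab (color_sym schemeS e)) stab_shiftl.
Qed.

Local Notation L := (stab x1 x0).
Local Notation R := (stab x0 x1).

Lemma card_stab_base : #|R| = p /\ #|L| = p.
Proof.
have n01 := arrow_not_sim arrow01.
by rewrite !card_stab !valency_out ?color_in // sim_sym.
Qed.

(** Two groups of order [p] meet trivially unless equal; if equal, they would give a strongly normal
    subset with [p] elements containing the residue, which has [p ^ 2]. *)
Lemma stab_TI : (L :&: R = 1)%g.
Proof.
have [cR cL] := card_stab_base; apply: prime_TIg; rewrite ?cL //.
apply/negP=> LR; have eLR : L = R.
  by apply/eqP; rewrite eqEcard LR cL cR /=.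
have /thin_residue_sub/subset_leq_card : strongly_normal S (f @: R).
  apply: (strongly_normal_imf (H := stab_group x0 x1)) => x y /arrow_stab[-> ->].
  by rewrite eLR.
rewrite -f_im !card_imset // cardsT card_gT cR; apply/negP.
by rewrite -ltnNge expnS expn1 ltn_Pmull ?prime_gt1 ?prime_gt0.
Qed.

Lemma stab_mul a : exists2 l, l \in L & exists2 r, r \in R & a = (l * r)%g.
Proof.
have [cR cL] := card_stab_base.
have : a \in (L * R)%g.
  suff /eqP-> : (L * R)%g == setT by rewrite inE.
  rewrite eqEcard subsetT cardsT card_gT /= (TI_cardMg stab_TI).
  by rewrite cL cR expnS expn1.
by case/mulsgP=> l r lL rR ->; exists l => //; exists r.
Qed.

Lemma color_stabr x y r : arrow x y -> r \in R -> c x (shift y r) = c x y.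
Proof. by case/arrow_stab=> <- _; rewrite inE => /eqP. Qed.

Lemma color_stabl x y l : arrow x y -> l \in L -> c (shift x l) y = c x y.
Proof.
by case/arrow_stab=> _ <-; rewrite inE => /eqP e; apply: color_sym.
Qed.

Lemma arrow_shift x y a b : arrow x y -> arrow (shift x a) (shift y b).
Proof. by apply: arrow_sim; apply: sim_shift. Qed.

Lemma order_stab a : a \in L \/ a \in R -> a != 1%g -> #[a]%g = p.
Proof.
have [cR cL] := card_stab_base.
move=> aLR a1; apply/prime_nt_dvdP; rewrite ?order_eq1 //.
by case: aLR; move=> /order_dvdG; rewrite ?cL ?cR.
Qed.

(** Moving the tail of the base arrow by a nontrivial [r] in [R] amounts to moving its head by some
    [a]. The factor of [a] in [R] does not affect the color; the factor in [L] is [l]. *)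
Lemma stab_generators : exists l r,
  [/\ l \in L, r \in R, #[l]%g = p, #[r]%g = p
    & forall x y, arrow x y -> c (shift x r) y = c x (shift y l)].
Proof.
have [cR cL] := card_stab_base.
have [r rR r1] : exists2 r, r \in R & r != 1%g.
  apply/trivgPn; rewrite trivg_card1 /= cR.
  by apply: contraTneq p_prime => ->.
have [|a ea] := @arrow_base (shift x0 r) x1.
  by rewrite -(shift1 x1); apply: arrow_shift.
have [l lL [r' r'R ea']] := stab_mul a.
have el : c (shift x0 r) x1 = c x0 (shift x1 l).
  rewrite ea ea' -shiftM color_stabr // -(shift1 x0).
  exact: arrow_shift.
(* If [l] were 1, then [r] would fix the color from the tail as well, and lie in both [L] and
   [R]. *)
have l1 : l != 1%g.
  apply: contra_neq r1 => l1; apply/set1gP; rewrite -stab_TI inE rR andbT inE.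
  by apply/eqP/(color_sym schemeS); rewrite el l1 shift1.
exists l, r; split=> //; rewrite ?(order_stab _ _) //; try by [left | right].
move=> x y /arrow_base[b e].
rewrite (color_shiftl r e) (color_shiftr l e) shiftM gT_abelian -shiftM.
exact: color_shiftr.
Qed.

(** Following [s0] from [x1] twice leads to [shift x0 (l * r)]. Moving [x0] by [l] in [L] keeps its
    color to [x1], and the remaining [r] in [R] is not seen from [x2]. *)
Lemma exists_triangle : exists y0 x2,
  [/\ c y0 x1 = s0, c x1 x2 = s0 & c x2 y0 = s0].
Proof.
have [x2 [x12 arrow12]] := arrow_exists x1.
have [arrow20 _] := arrow_cycle arrow01 arrow12.
have [y [x2y arrow2y]] := arrow_exists x2.
have /simP[a ey] := arrow_fun arrow20 arrow2y.
have [l lL [r rR ea]] := stab_mul a.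
exists (shift x0 l), x2; split=> //; first by rewrite color_stabl.
rewrite -x2y ey ea -shiftM (color_stabr _ rR) //.
by rewrite -(shift1 x2); apply: arrow_shift.
Qed.
Lemma exists_cycle : exists b : 'Z_3 -> X, forall i, c (b i) (b (i + 1)%R) = s0.
Proof.
have [y0 [x2 [e0 e1 e2]]] := exists_triangle.
by exists (fun i => nth y0 [:: y0; x1; x2] i); case=> [[|[|[|]]]].
Qed.

(** As [p] is greater than 1, the elements of ['Z_p] are exactly the reduced exponents modulo
    [p]. *)
Lemma expg_Zp_inj a : #[a]%g = p -> injective (fun m : 'Z_p => (a ^+ m)%g).
Proof.
move=> oa m n /eqP; rewrite eq_expg_mod_order oa => /eqP e; apply: val_inj.
have lt (k : 'Z_p) : k < p by rewrite -[X in _ < X](Zp_cast (prime_gt1 p_prime)).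
by rewrite !modn_small in e.
Qed.

Lemma expg_ZpD a (m n : 'Z_p) :
  #[a]%g = p -> (a ^+ (m + n)%R = a ^+ m * a ^+ n)%g.
Proof.
move=> oa; rewrite -expgD; apply/eqP; rewrite eq_expg_mod_order oa /=.
by rewrite [X in _ %% X == _ %[mod _]](Zp_cast (prime_gt1 p_prime)) modn_mod.
Qed.

Lemma expg_ZpN a (m : 'Z_p) : #[a]%g = p -> (a ^+ (- m)%R = a ^- m)%g.
Proof.
by move=> oa; apply/eqP; rewrite eq_sym eq_invg_mul -expg_ZpD // GRing.addrN expg0.
Qed.

(** * Coordinates *)

Section Model.
Variables (b : 'Z_3 -> X) (l r : gT).
Hypotheses (bE : forall i, c (b i) (b (i + 1)%R) = s0).
Hypotheses (lL : l \in L) (rR : r \in R) (ol : #[l]%g = p) (or : #[r]%g = p).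
Hypothesis shift_rl :
  forall x y, arrow x y -> c (shift x r) y = c x (shift y l).

Definition model_point (u : 'Z_3 * ('Z_p * 'Z_p)) : X :=
  shift (b u.1) (l ^+ u.2.1 * r ^+ u.2.2).

Let arrow_b i : arrow (b i) (b (i + 1)%R).
Proof. by apply/arrowP; exists (b (i + 1)%R); rewrite bE sim_refl. Qed.

Lemma shift_rl_exp n x y :
  arrow x y -> c (shift x (r ^+ n)) y = c x (shift y (l ^+ n)).
Proof.
move=> xy; elim: n => [|n IHn]; first by rewrite !expg0 !shift1.
rewrite expgS gT_abelian -shiftM shift_rl; last by rewrite -(shift1 y) arrow_shift.
by rewrite (color_shiftr l IHn) shiftM -expgSr.
Qed.

(** The factor [l ^+ m] at the tail and [r ^+ n'] at the head leave the color unchanged, while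
    [r ^+ n] at the tail turns into [l ^+ n] at the head. *)
Lemma color_arrow_model (m n m' n' : 'Z_p) x y : arrow x y ->
  c (shift x (l ^+ m * r ^+ n)) (shift y (l ^+ m' * r ^+ n')) =
  c x (shift y (l ^+ (m' + n)%R)).
Proof.
move=> xy; rewrite gT_abelian -shiftM -[shift y _]shiftM.
rewrite color_stabl ?groupX //; last by rewrite shiftM arrow_shift.
rewrite color_stabr ?groupX //; last by rewrite arrow_shift.
rewrite shift_rl_exp; last by rewrite -(shift1 x) arrow_shift.
by rewrite shiftM expg_ZpD.
Qed.

(** The quotient of the two powers of [l] fixes the color from the head, so it lies in both [L] and
    [R]. *)
Lemma color_arrow_inj (m m' : 'Z_p) x y :
  arrow x y -> c x (shift y (l ^+ m)) = c x (shift y (l ^+ m')) -> m = m'.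
Proof.
move=> xy /eqP e; apply: (expg_Zp_inj ol) => /=.
have: (l ^- m' * l ^+ m \in [1 gT])%g.
  rewrite -stab_TI inE groupM ?groupV ?groupX //=.
  have [<- _] := arrow_stab xy.
  by rewrite -(stab_shiftr _ _ (l ^+ m')) inE shiftM mulKVg.
by move/set1gP/eqP; rewrite -eq_mulVg1 => /eqP.
Qed.

Lemma mul_expg_inj (m n m' n' : 'Z_p) :
  (l ^+ m * r ^+ n = l ^+ m' * r ^+ n')%g -> m = m' /\ n = n'.
Proof.
move=> e; suff em : m = m'.
  by split=> //; rewrite em in e; move/mulgI: e; apply: expg_Zp_inj.
apply: (expg_Zp_inj ol) => /=.
have: (l ^- m' * l ^+ m \in [1 gT])%g.
  rewrite -stab_TI inE groupM ?groupV ?groupX //=.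
  suff ->: (l ^- m' * l ^+ m = r ^+ n' * r ^- n)%g by rewrite groupM ?groupV ?groupX.
  by apply/eqP; rewrite -(canF_eq (mulgK _)) -mulgA e mulKg.
by move/set1gP/eqP; rewrite -eq_mulVg1 => /eqP.
Qed.

(** Expressed through [x0] and [x1] rather than the base points [b], so that the color of a pair
    depends on its model color alone. *)
Definition color_of_model (k : 'Z_3 * ('Z_p * 'Z_p)) : {set X * X} :=
  let y := shift x1 (l ^+ k.2.1) in
  if k.1 == 0%R then f (l ^+ k.2.1 * r ^+ k.2.2)
  else if k.1 == 1%R then c x0 y else c y x0.

Let color_of_model0 m n : color_of_model (0, (m, n))%R = f (l ^+ m * r ^+ n).
Proof. by []. Qed.

Lemma color_model u v :
  c (model_point u) (model_point v) = color_of_model (model_color u v).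
Proof.
case: u v => [i [m n]] [j [m' n']].
rewrite /model_color /model_point /=.
have arrow_model k (a d : 'Z_p) (a' d' : 'Z_p) :
    c (shift (b k) (l ^+ a * r ^+ d)) (shift (b (k + 1)%R) (l ^+ a' * r ^+ d')) =
    c x0 (shift x1 (l ^+ (a' + d)%R)).
  by rewrite color_arrow_model //; apply: color_shiftr; rewrite bE x01.
case: (j =P i) => [->|/eqP ji].
  rewrite color_of_model0 color_shift !expg_ZpD // !expg_ZpN //; congr (f _).
  by rewrite gT_abelian invMg -!mulgA; congr (_ * _)%g; rewrite mulgA gT_abelian.
case: (j =P (i + 1)%R) => [->|/eqP ji1]; first exact: arrow_model.
have /eqP-> : i == (j + 1)%R by move: (Z3_cases i j); rewrite (negPf ji) (negPf ji1).
(* A reversed arrow: the roles of [u] and [v] are exchanged, whence the sum in the last branch of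
   [model_color]. *)
by apply: color_sym => //; apply: arrow_model.
Qed.

(** Membership in the residue and [arrow_asym] separate the three kinds of colors; within each kind
    the exponents are determined because [L] and [R] meet trivially. *)
Lemma color_model_inj u v u' v' :
  color_of_model (model_color u v) = color_of_model (model_color u' v') ->
  model_color u v = model_color u' v'.
Proof.
(* Between distinct classes [color_of_model] forgets the last coordinate, which is recovered because
   [model_color] sets it to 0. *)
pose red (k : 'Z_3 * ('Z_p * 'Z_p)) := (k.1 != 0)%R -> k.2.2 = 0%R.
have redE (w t : 'Z_3 * ('Z_p * 'Z_p)) : red (model_color w t).
  by rewrite /red /model_color; case: ifP => // _; case: ifP.
have {redE} := (redE u v, redE u' v').
have a01 (m : 'Z_p) : arrow x0 (shift x1 (l ^+ m)).
  by rewrite -(shift1 x0) arrow_shift.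
have notN0 (m : 'Z_p) := arrow_not_sim (a01 m).
have notN1 (m : 'Z_p) : c (shift x1 (l ^+ m)) x0 \notin N by rewrite sim_sym.
have arr (m n : 'Z_p) : c x0 (shift x1 (l ^+ m)) <> c (shift x1 (l ^+ n)) x0.
  move=> e; have := arrow_color e (a01 m).
  by apply/negP/arrow_asym.
case: (model_color u v) (model_color u' v') => [i [m n]] [j [m' n']].
rewrite /red /color_of_model /=.
have Z3 (k : 'Z_3) : [|| k == 0, k == 1 | k == 1 + 1]%R.
  by case: k => [[|[|[|]]]].
case/or3P: (Z3 i) => /eqP->; case/or3P: (Z3 j) => /eqP-> //= [redn redn'].
- by move/f_inj/mul_expg_inj=> [-> ->].
- by move=> e; have := notN0 m'; rewrite -e f_in.
- by move=> e; have := notN1 m'; rewrite -e f_in.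
- by move=> e; have := notN0 m; rewrite e f_in.
- by move/(color_arrow_inj arrow01)=> ->; rewrite redn ?redn'.
- by move/arr.
- by move=> e; have := notN1 m; rewrite e f_in.
- by move/esym/arr.
- by move/(color_sym schemeS)/(color_arrow_inj arrow01)=> ->; rewrite redn ?redn'.
Qed.

Lemma model_point_bij : bijective model_point.
Proof.
apply: inj_card_bij => [u v e|].
  apply: model_color_eqxx; apply: color_model_inj.
  by rewrite -!color_model e.
by rewrite card_X !card_prod !card_ord (Zp_cast (prime_gt1 p_prime)).
Qed.

End Model.

Lemma thin_action_model : exists F : 'Z_3 * ('Z_p * 'Z_p) -> X, bijective F /\
  forall u v u' v', c (F u) (F v) = c (F u') (F v') <->
                    model_color u v = model_color u' v'.
Proof.
have [b bE] := exists_cycle.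
have [l [r [lL rR ol or rl]]] := stab_generators.
exists (model_point b l r); split; first exact: model_point_bij.
by move=> u v u' v'; rewrite !color_model //; split=> [|->//]; apply: color_model_inj.
Qed.

End ThinAction.

(** * Coordinates from the hypotheses on the scheme *)

Lemma scheme_model p (X : finType) (S : {set {set X * X}}) :
  prime p -> is_scheme S ->
  thin_isog S (thin_residue S) ('Z_p * 'Z_p)%type ->
  [seq valency s | s in S :\: thin_residue S] =i pred1 p ->
  delta S = 3%:R%R ->
  exists F : 'Z_3 * ('Z_p * 'Z_p) -> X, bijective F /\
    forall u v u' v', color S (F u) (F v) = color S (F u') (F v') <->
                      model_color u v = model_color u' v'.
Proof.
move=> p_prime schemeS [thinN [f [f_inj f_im fM]]] valS deltaS.
have card_gT : #|{: 'Z_p * 'Z_p}| = p ^ 2.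
  by rewrite card_prod card_ord Zp_cast ?prime_gt1.
have abel (a b : 'Z_p * 'Z_p) : (a * b = b * a)%g.
  by congr (_, _); apply: GRing.addrC.
have valN : valency_sum (thin_residue S) = p ^ 2.
  rewrite -card_gT -cardsT -(card_imset _ f_inj) f_im -sum1_card.
  by apply: eq_bigr => t tN; case/andP: thinN => _ /forall_inP/(_ t tN)/eqP.
have card_X : #|X| = 3 * p ^ 2.
  have p2 : ((p ^ 2)%:R != 0 :> rat)%R.
    by rewrite Num.Theory.pnatr_eq0 -lt0n expn_gt0 prime_gt0.
  move: deltaS; rewrite /delta valN valency_sum_scheme // => /(canRL (GRing.divfK p2)).
  by rewrite -GRing.natrM => /eqP; rewrite Num.Theory.eqr_nat => /eqP.
have val_out s : s \in S -> s \notin thin_residue S -> valency s = p.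
  move=> sS sN; apply/eqP; rewrite -[_ == _]/(_ \in pred1 p) -valS.
  by apply/imageP; exists s; rewrite // inE sN.
(* Since [p] occurs among the valencies outside the residue, there is a relation outside it. *)
have [s0 s0P _] : exists2 s0, s0 \in S :\: thin_residue S & p = valency s0.
  by apply/imageP; rewrite valS inE.
have [s0S s0N] := setDP s0P.
have [x0 _] : exists x, x \in X by case: (schemeS) => /card_gt0P.
have [x1 x01] := color_exists schemeS x0 s0S.
exact: (thin_action_model schemeS thinN f_inj f_im fM abel p_prime card_gT card_X
  val_out s0S s0N x01).
Qed.

(** * From colors to isomorphisms *)

Section Induced.
Variables (X1 X2 : finType) (S1 : {set {set X1 * X1}}) (S2 : {set {set X2 * X2}}).
Hypotheses (scheme1 : is_scheme S1) (scheme2 : is_scheme S2).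
Variable f : X1 -> X2.
Hypothesis f_color : forall x y x' y',
  color S1 x y = color S1 x' y' -> color S2 (f x) (f y) = color S2 (f x') (f y').

(** The property of [t] is boolean so that [xchoose] can select the image relation. *)
Lemma induced_subproof (s : {s | s \in S1}) :
  exists t : {s | s \in S2},
    [forall z in val s, color S2 (f z.1) (f z.2) == val t].
Proof.
have [[x y] xys] := scheme_neq0 scheme1 (valP s).
exists (exist (fun t => t \in S2) _ (color_in scheme2 (f x) (f y))).
apply/forall_inP=> -[x' y'] xys'; apply/eqP/f_color.
by move: xys xys'; rewrite !(in_color scheme1) ?(valP s) // => /eqP-> /eqP->.
Qed.

Definition induced s := xchoose (induced_subproof s).

Lemma inducedE x y s :
  color S1 x y = val s -> val (induced s) = color S2 (f x) (f y).
Proof.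
move=> e; have /forall_inP/(_ (x, y)) := xchooseP (induced_subproof s).
by move=> /(_ _)/eqP/esym; apply; rewrite -e mem_color.
Qed.

End Induced.

(** Both [f] and its inverse preserve equality of colors, so each induces a map on relations;
    evaluating on a pair that represents a relation shows these maps to be mutually inverse. *)
Lemma scheme_isomorphic_color (X1 X2 : finType)
    (S1 : {set {set X1 * X1}}) (S2 : {set {set X2 * X2}}) (f : X1 -> X2) :
  is_scheme S1 -> is_scheme S2 -> bijective f ->
  (forall x y x' y', color S1 x y = color S1 x' y' <->
                     color S2 (f x) (f y) = color S2 (f x') (f y')) ->
  scheme_isomorphic S1 S2.
Proof.
move=> scheme1 scheme2 [h fK hK] fE.
have f_color x y x' y' := (fE x y x' y').1.
have h_color x y x' y' :
    color S2 x y = color S2 x' y' -> color S1 (h x) (h y) = color S1 (h x') (h y').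
  by move=> e; apply/fE; rewrite !hK.
pose g := induced scheme1 scheme2 f_color.
pose g' := induced scheme2 scheme1 h_color.
have val_color (X : finType) (S : {set {set X * X}}) (s : {s | s \in S}) :
    is_scheme S -> exists x y, color S x y = val s.
  move=> scheme; have [[x y] xys] := scheme_neq0 scheme (valP s).
  by exists x, y; apply/eqP; rewrite -(in_color scheme) ?(valP s).
have gK : cancel g g'.
  move=> s; have [x [y e]] := val_color _ _ s scheme1.
  apply: val_inj; rewrite (inducedE _ _ _ (esym (inducedE _ _ _ e))).
  by rewrite !fK.
have gK' : cancel g' g.
  move=> s; have [x [y e]] := val_color _ _ s scheme2.
  apply: val_inj; rewrite (inducedE _ _ _ (esym (inducedE _ _ _ e))).
  by rewrite !hK.
exists (fun z => match z with inl x => inl (f x) | inr s => inr (g s) end), f, g.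
split=> // [|x y s].
  exists (fun z => match z with inl x => inl (h x) | inr s => inr (g' s) end).
    by case=> z; rewrite ?fK ?gK.
  by case=> z; rewrite ?hK ?gK'.
rewrite (in_color scheme1) ?(valP s) // => /eqP /(inducedE scheme1 scheme2 f_color) ->.
exact: mem_color.
Qed.

Theorem theorem3p3 (p : nat) (p_prime : prime p) (X1 X2 : finType)
    (S1 : {set {set X1 * X1}}) (S2 : {set {set X2 * X2}})
    (scheme1 : is_scheme S1) (scheme2 : is_scheme S2)
    (thin1 : thin_isog S1 (thin_residue S1) ('Z_p * 'Z_p)%type)
    (thin2 : thin_isog S2 (thin_residue S2) ('Z_p * 'Z_p)%type)
    (val1 : [seq valency s | s in S1 :\: thin_residue S1] =i pred1 p)
    (val2 : [seq valency s | s in S2 :\: thin_residue S2] =i pred1 p)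
    (delta1 : delta S1 = 3%:R%R) (delta2 : delta S2 = 3%:R%R) :
  scheme_isomorphic S1 S2.
Proof.
have [F1 [[G1 F1K G1K] F1E]] := scheme_model p_prime scheme1 thin1 val1 delta1.
have [F2 [F2_bij F2E]] := scheme_model p_prime scheme2 thin2 val2 delta2.
(* The point map goes from [X1] to [X2] through the common model. *)
apply: (@scheme_isomorphic_color _ _ _ _ (F2 \o G1)) => // [|x y x' y'].
  by apply: bij_comp => //; exists F1.
rewrite /= -{1}(G1K x) -{1}(G1K y) -{1}(G1K x') -{1}(G1K y').
by split=> [/F1E/F2E|/F2E/F1E].
Qed.
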